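(* Let $q$ be an odd power of an odd prime and let $r\ge1$ be an integer. If there is a $\mu\in\mathbb{F}_q$ such that $x^{2r+1}-\mu$ is irreducible in $\mathbb{F}_q[x]$, then \[ \chi(ER_{q^{2r+1}})\le \frac{2r+5}{3}\,q^{\frac{4r}{3}+1}+(2r+1)q^{r+1}+1. \]
   Context: For a prime power $Q$, $ER_Q$ is the graph whose vertices are the points of $PG(2,Q)$, i.e. the $1$-dimensional subspaces of $\mathbb{F}_Q^3$, where distinct vertices $(x_0,x_1,x_2)$ and $(y_0,y_1,y_2)$ (homogeneous coordinates) are adjacent if and only if $x_0y_0+x_1y_1+x_2y_2=0$. $\chi$ denotes the chromatic number. *)

(* Defs.v *)
From HB Require Import structures.
From mathcomp Require Import all_boot all_order all_algebra all_field.
Set Implicit Arguments. Unset Strict Implicit. Unset Printing Implicit Defensive.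
Import GRing.Theory.
Local Open Scope ring_scope.

Section Chromatic.
Variables (V : finType) (e : rel V).

Definition colorableb (n : nat) : bool :=
  [exists f : {ffun V -> 'I_n},
     [forall x, forall y, ((x != y) && e x y) ==> (f x != f y)]].

Lemma colorable_exists : exists n, colorableb n.
Proof.
exists #|V|; apply/existsP; exists [ffun x => enum_rank x].
apply/forallP=> x; apply/forallP=> y; apply/implyP=> /andP[nxy _].
rewrite !ffunE; apply: contra nxy => /eqP/enum_rank_inj ->; exact: eqxx.
Qed.

Definition chromatic_number : nat := ex_minn colorable_exists.
End Chromatic.

Section ER.
Variable K : finFieldType.

Definition dot3 (v w : 'rV[K]_3) : K := \sum_(i < 3) v 0 i * w 0 i.

Definition is_point (S : {set 'rV[K]_3}) : bool :=
  [exists v : 'rV[K]_3, (v != 0) && (S == [set a *: v | a : K])].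

Definition PG2 := {S : {set 'rV[K]_3} | is_point S}.

Definition ER_adj : rel PG2 := fun S T =>
  (S != T) && [forall v in val S, forall w in val T, dot3 v w == 0].
End ER.

Definition Xn_sub_C (F : fieldType) (n : nat) (mu : F) : {poly F} := 'X^n - mu%:P.

From Stdlib Require Import Reals.

(* Main.v *)
Require Import Defs.
From HB Require Import structures.
From mathcomp Require Import all_boot all_order all_algebra all_field.
From mathcomp Require Import fingroup cyclic ring zify.

(** Choose [a, b] with [a^2 + b^2 = -1]. In suitable isotropic coordinates
    [(l, m, r)] the form is [2 <x, y> = l r' + r l' - 2 m m'], so a point with
    [l <> 0] is a pair [(c, z) = (m / l, r / l - c^2)], and adjacency reads
    [z + z' = - (c - c')^2]. The points with [l = 0] need two more colors.

    Let [theta] generate the multiplicative group of [K], and let [X], resp.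
    [W], be the span over the prime field of the first [k], resp. [2k - 1],
    powers of [theta]; squares of elements of [X] lie in [W]. The pairs with
    [z] outside [W] are colored by the class of [c] modulo [X] together with a
    sign of [z] modulo [W]. Among those with [z] in [W], adjacency forces
    [(c - c')^2] into [W], so degrees are at most [2 |W|] and greedy coloring
    applies. With [|K| = p^m] this gives at most
    [2 p^(2k - 1) + 2 p^(m - k) + 3] colors; [k] is taken near [m / 3]. *)

Set Implicit Arguments. Unset Strict Implicit. Unset Printing Implicit Defensive.
Import GRing.Theory.
Local Open Scope ring_scope.

(** * Colorings of finite graphs *)

Lemma chromatic_number_le (V C : finType) (e : rel V) (f : V -> C) :
  (forall x y, x != y -> e x y -> f x != f y) -> (chromatic_number e <= #|C|)%N.
Proof.
move=> fP; rewrite /chromatic_number; case: ex_minnP => n _; apply.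
apply/existsP; exists [ffun x => enum_rank (f x)].
apply/forallP => x; apply/forallP => y; apply/implyP => /andP[xy exy].
by rewrite !ffunE (inj_eq enum_rank_inj) fP.
Qed.

(** Vertices are colored one at a time; the new vertex only has to avoid the at most [D] colors that
    [f] takes on its neighbors. *)
Lemma greedy_coloring (T : finType) (e : rel T) (D : nat) :
  symmetric e -> (forall x, #|[set y | e x y]| <= D)%N ->
  exists f : T -> 'I_D.+1, forall x y, x != y -> e x y -> f x != f y.
Proof.
move=> syme degD.
suff [f fP] : exists f : T -> 'I_D.+1,
    {in enum T &, forall x y, x != y -> e x y -> f x != f y}.
  by exists f => x y; apply: fP; rewrite mem_enum.
elim: (enum T) => [|a s [f fP]]; first by exists (fun=> ord0).
have /existsP[c cP] : [exists c, c \notin f @: [set y | e a y]].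
  rewrite -negb_forall; apply/negP => /forallP all_in.
  have := leq_trans (leq_imset_card f _) (degD a).
  have -> : f @: [set y | e a y] = [set: 'I_D.+1].
    by apply/setP => c; rewrite all_in inE.
  by rewrite cardsT card_ord ltnn.
have avoid y : e a y -> c != f y.
  by move=> eay; apply: contraNneq cP => ->; rewrite imset_f ?inE.
exists (fun x => if x == a then c else f x) => x y.
rewrite !inE; case: (eqVneq x a) => [->|xa] /=; case: (eqVneq y a) => [->|ya] //=.
- by move=> _ _ _; apply: avoid.
- by move=> _ _ _; rewrite eq_sym syme; apply: avoid.
exact: fP.
Qed.

(** Numbers the values of [h], so that cosets can serve as colors. *)
Lemma card_image_ord (T U : finType) (h : T -> U) (n : nat) :
  (#|[set h x | x : T]| <= n)%N ->
  exists h' : T -> 'I_n, forall x y, h' x = h' y -> h x = h y.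
Proof.
move=> hn; have hin x : h x \in [set h x | x : T] by apply: imset_f.
exists (fun x => widen_ord hn (enum_rank_in (hin x) (h x))) => x y.
by move=> /(congr1 val) /= /val_inj/enum_rank_in_inj; apply.
Qed.

(** * Spans of consecutive powers of one element *)

Section PowerSpan.
Variables (F : fieldType) (L : falgType F) (theta : L).

Definition power_span k : {vspace L} := <<[seq (theta ^+ i)%R | i <- iota 0 k]>>%VS.

Lemma mem_power_span k i : (i < k)%N -> theta ^+ i \in power_span k.
Proof. by move=> ik; apply/memv_span/map_f; rewrite mem_iota. Qed.

Lemma power_spanS k : power_span k.+1 = (power_span k + <[(theta ^+ k)%R]>)%VS.
Proof.
by rewrite /power_span -addn1 iotaD map_cat span_cat /= span_seq1.
Qed.

Lemma power_span_sub k l : (k <= l)%N -> (power_span k <= power_span l)%VS.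
Proof.
move=> kl; apply/span_subvP => x /mapP[i]; rewrite mem_iota => /andP[_ ik] ->.
by apply: mem_power_span; apply: leq_trans kl.
Qed.

Lemma dim_power_span_le k : (\dim (power_span k) <= k)%N.
Proof. by apply: leq_trans (dim_span _) _; rewrite size_map size_iota. Qed.

Lemma power_span_mul_mem k i x :
  x \in power_span k -> x * theta ^+ i \in power_span (k + i).
Proof.
move=> xk.
have : (amulr (theta ^+ i) @: power_span k <= power_span (k + i))%VS.
  rewrite limg_span; apply/span_subvP => u /mapP[v /mapP[j jk ->] ->].
  rewrite lfunE /= -exprD; apply: mem_power_span.
  by move: jk; rewrite mem_iota add0n ltn_add2r.
move/subvP/(_ (x * theta ^+ i)); apply.
by apply/memv_imgP; exists x; rewrite ?lfunE.
Qed.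

(** Products of [theta ^+ i] with [i < k] and [theta ^+ j] with [j <= l] have exponent below
    [k + l]. *)
Lemma power_spanM k l x y :
  x \in power_span k -> y \in power_span l.+1 -> x * y \in power_span (k + l).
Proof.
move=> xk yl.
have : (amull x @: power_span l.+1 <= power_span (k + l))%VS.
  rewrite limg_span; apply/span_subvP => u /mapP[v /mapP[j jl ->] ->].
  rewrite lfunE /=; apply: subvP (power_span_mul_mem j xk).
  by apply: power_span_sub; rewrite leq_add2l; move: jl; rewrite mem_iota.
move/subvP/(_ (x * y)); apply.
by apply/memv_imgP; exists y; rewrite ?lfunE.
Qed.

(* If [theta ^+ k] depends on lower powers, multiplication by [theta]
   preserves their span. *)
Lemma power_span_stable k j :
  theta ^+ k \in power_span k -> theta ^+ j \in power_span k.
Proof.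
move=> tk; elim: j => [|j IHj].
  by case: k tk => [//|k _]; apply: mem_power_span.
rewrite exprSr; have : theta ^+ j * theta ^+ 1 \in power_span (k + 1).
  exact: power_span_mul_mem.
rewrite expr1 addn1 power_spanS => /memv_addP[u uk [v /vlineP[c ->] ->]].
by rewrite memvD // memvZ.
Qed.

(** Were [theta ^+ k] in the span of the lower powers, that span would contain every power, hence
    all of [L], although its dimension is only [k]. *)
Lemma dim_power_span k :
  (forall x : L, x != 0 -> exists j, x = theta ^+ j) ->
  (k <= \dim {:L})%N -> \dim (power_span k) = k.
Proof.
move=> gen; elim: k => [|k IHk] km.
  by apply/eqP; rewrite -leqn0 dim_power_span_le.
apply/eqP; rewrite eqn_leq dim_power_span_le /=.
rewrite -{1}(IHk (ltnW km)) ltn_neqAle dimvS ?power_span_sub // andbT.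
apply/negP => /eqP E.
have tk : theta ^+ k \in power_span k.
  apply: (subvP _) (mem_power_span (ltnSn k)).
  by have [_ <-] := dimv_leqif_sup (power_span_sub (leqnSn k)); rewrite E.
suff : (fullv <= power_span k)%VS.
  by move/dimvS; rewrite IHk ?(ltnW km) // leqNgt km.
apply/subvP => x _; have [->|/gen[j ->]] := eqVneq x 0; first exact: mem0v.
exact: power_span_stable.
Qed.

End PowerSpan.

(** * Quotients and squares in finite fields *)

Lemma finField_generator (K : finFieldType) :
  exists theta : K, forall x, x != 0 -> exists j, x = theta ^+ j.
Proof.
have /cyclicP[u Eu] := field_unit_group_cyclic [set: {unit K}]%G.
exists (val u) => x x0; have ux : x \is a GRing.unit by rewrite unitfE.
have : FinRing.unit K ux \in <[u]>%g by rewrite -Eu inE.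
case/cycleP=> j /(congr1 val) /= ->; exists j.
by rewrite FinRing.val_unitX.
Qed.

(* [f] labels the cosets of [X]; [g] is a projection with kernel [W]. *)
Lemma additive_quotients (K : finFieldType) (p m k : nat) :
  prime p -> #|K| = (p ^ m)%N -> (0 < k <= m)%N ->
  exists (f : K -> 'I_(p ^ (m - k))) (g : K -> K),
    [/\ {morph g : x y / x - y},
        (#|[set x | g x == 0%R]| <= p ^ (2 * k).-1)%N
      & forall x y, f x = f y -> g ((x - y) ^+ 2) = 0].
Proof.
move=> pp cK /andP[k0 km].
have cp : p \in [pchar K] by apply: card_finPcharP cK pp.
have [theta gen] := finField_generator K.
pose L := pPrimeCharType cp : splittingFieldType 'F_p.
have dimL : \dim {:L} = m.
  by rewrite pprimeChar_dimf cK pfactorK.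
have cV (V : {vspace L}) : #|[set x : K | (x : L) \in V]| = (p ^ \dim V)%N.
  by rewrite -[X in (X ^ _)%N](card_Fp pp) -card_vspace cardsE.
pose proj (V : {vspace L}) (x : K) : K := (x : L) - projv V x.
have projB V : {morph proj V : x y / x - y}.
  by move=> x y; rewrite /proj linearB /= opprD addrACA -opprD.
have ker_proj V x : (proj V x == 0) = ((x : L) \in V).
  rewrite subr_eq0; apply/eqP/idP => [-> | xV]; first exact: memv_proj.
  by rewrite projv_id.
pose X := power_span (theta : L) k; pose W := power_span (theta : L) (2 * k).-1.
have dX : \dim X = k by apply: dim_power_span; rewrite ?dimL.
have [f fP] : exists f : K -> 'I_(p ^ (m - k)),
    forall x y, f x = f y -> proj X x = proj X y.
  (* [proj X] takes its values in the complement of [X], which has [p ^ (m - k)] elements. *)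
  apply: card_image_ord; rewrite -dX -dimL -dimv_compl -cV.
  apply: subset_leq_card.
  by apply/subsetP => _ /imsetP[x _ ->]; rewrite inE memv_projC.
exists f, (proj W); split; first exact: projB.
  have -> : [set x | proj W x == 0] = [set x : K | (x : L) \in W].
    by apply/setP => x; rewrite !inE ker_proj.
  by rewrite cV leq_exp2l ?prime_gt1 // dim_power_span_le.
move=> x y /fP /eqP; rewrite -subr_eq0 -projB ker_proj => xyX.
apply/eqP; rewrite ker_proj.
(* Splits [2k - 1] as [k + (k - 1)], the shape required by [power_spanM]. *)
rewrite /W mul2n -addnn -[in X in power_span _ X](prednK k0) addnS /=.
by apply: power_spanM; rewrite ?prednK.
Qed.

Lemma card_sqr_preim (K : finFieldType) (A : {set K}) :
  (#|[set x | (x ^+ 2)%R \in A]| <= 2 * #|A|)%N.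
Proof.
rewrite -sum1_card (partition_big (fun x => x ^+ 2) (mem A)) /=; last first.
  by move=> x; rewrite inE.
rewrite mulnC -sum_nat_const; apply: leq_sum => w _; rewrite sum1_card.
have [x0 /andP[_ /eqP x0w]|none] :=
    pickP [pred x | (x \in [set x | x ^+ 2 \in A]) && (x ^+ 2 == w)]; last first.
  by rewrite eq_card0.
apply: leq_trans (_ : #|[set x0; - x0]| <= _)%N.
  apply/subset_leq_card/subsetP => x; rewrite !inE => /andP[_].
  by rewrite -x0w eqf_sqr.
by rewrite cards2; case: (_ != _).
Qed.

(** As [#|K|] is odd, the squares [s] and the elements [-1 - s] each fill more than half of [K], so
    the two sets meet. *)
Lemma sum_two_sqr_eqN1 (K : finFieldType) :
  odd #|K| -> exists a b : K, a ^+ 2 + b ^+ 2 = -1.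
Proof.
move=> oddK; pose Sq : {set K} := [set x ^+ 2 | x : K].
pose T : {set K} := [set -1 - s | s in Sq].
have cT : #|T| = #|Sq| by rewrite card_imset // => x y /addrI/oppr_inj.
have cSq : (#|K| <= 2 * #|Sq|)%N.
  apply: leq_trans (card_sqr_preim Sq); rewrite -cardsT.
  by apply/subset_leq_card/subsetP => x _; rewrite inE; apply: imset_f.
have /set0Pn[s] : Sq :&: T != set0.
  apply/negP => /eqP ST0.
  have := cardsU Sq T; rewrite ST0 cards0 cT.
  have : (#|Sq :|: T| <= #|K|)%N by apply: max_card.
  move: oddK cSq; lia.
rewrite inE => /andP[/imsetP[a _ ->] /imsetP[_ /imsetP[b _ ->] ab]].
by exists a, b; rewrite ab subrK.
Qed.

Lemma two_neq0 (K : finFieldType) (p m : nat) :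
  prime p -> odd p -> #|K| = (p ^ m)%N -> 2 != 0 :> K.
Proof.
move=> pp oddp cK; rewrite -(dvdn_pcharf (card_finPcharP cK pp)) dvdn_prime2 //.
by apply: contraL oddp => /eqP ->.
Qed.

(** * Coloring the points with [l <> 0] *)

(** [g] stands for reduction modulo [W], [D] for a bound on the size of [W], and [f] for the class
    modulo [X]. *)
Lemma parabola_coloring (K : finFieldType) (g : K -> K) (N D : nat) (f : K -> 'I_N) :
  2 != 0 :> K -> {morph g : x y / x - y} -> (#|[set x | g x == 0%R]| <= D)%N ->
  (forall x y, f x = f y -> g ((x - y) ^+ 2) = 0) ->
  exists col : K * K -> 'I_(2 * D).+1 + bool * 'I_N,
    forall P Q, P != Q -> P.2 + Q.2 = - (P.1 - Q.1) ^+ 2 -> col P != col Q.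
Proof.
move=> two0 gB gD fg.
have g0 : g 0 = 0 by have := gB 0 0; rewrite !subrr.
have gN x : g (- x) = - g x by rewrite -[- x]sub0r gB g0 sub0r.
have gDD x y : g (x + y) = g x + g y by rewrite -[y in LHS]opprK gB gN opprK.
pose e (P Q : K * K) :=
  [&& g P.2 == 0, g Q.2 == 0 & P.2 + Q.2 == - (P.1 - Q.1) ^+ 2].
have syme : symmetric e.
  by move=> P Q; rewrite /e andbCA addrC -(sqrrN (P.1 - _)) opprB.
have dege P : (#|[set Q | e P Q]| <= 2 * D)%N.
  apply: leq_trans (leq_mul (leqnn 2) gD); apply: leq_trans (card_sqr_preim _).
  (* A neighbor [Q] of [P] is determined by [P.1 - Q.1], whose square is killed by [g]. *)
  rewrite -(@card_in_imset _ _ (fun Q => P.1 - Q.1)) => [|Q Q'].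
    apply/subset_leq_card/subsetP => _ /imsetP[Q + ->].
    rewrite !inE => /and3P[/eqP gP /eqP gQ /eqP PQ].
    by rewrite -[(_ ^+ 2)%R]opprK -PQ gN gDD gP gQ addr0 oppr0.
  rewrite !inE => /and3P[_ _ /eqP PQ] /and3P[_ _ /eqP PQ'] EQ.
  rewrite [Q]surjective_pairing [Q']surjective_pairing.
  move: PQ PQ'; rewrite EQ => <- /addrI ->.
  by move/addrI/oppr_inj : EQ => ->.
have [h hP] := greedy_coloring syme dege.
(* [g z] and [- g z] are distinct, and the order of [enum K] tells them apart. *)
pose sgn z := (enum_rank (g z) < enum_rank (- g z))%N.
exists (fun P => if g P.2 == 0 then inl (h P) else inr (sgn P.2, f P.1)).
move=> P Q PQ adj; have [gP|gP] := eqVneq (g P.2) 0;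
  have [gQ|gQ] := eqVneq (g Q.2) 0 => //.
  have ePQ : e P Q by rewrite /e gP gQ adj !eqxx.
  by have := hP P Q PQ ePQ; apply: contra => /eqP[->].
apply/negP => /eqP[Esgn /fg fPQ].
(* Equal labels make [g] vanish on the right side of the adjacency relation. *)
have gQP : g Q.2 = - g P.2.
  by apply/eqP; rewrite -addr_eq0 addrC -gDD adj gN fPQ oppr0.
move: Esgn; rewrite /sgn gQP opprK => Esgn.
have /val_inj/enum_rank_inj/eqP : enum_rank (g P.2) = enum_rank (- g P.2) :> nat.
  by case: ltngtP Esgn.
rewrite -addr_eq0 -mulr2n -mulr_natl mulf_eq0 (negPf two0).
by rewrite (negPf gP).
Qed.

(** * The bilinear form in isotropic coordinates *)

Lemma dot3E (K : finFieldType) (x y : 'rV[K]_3) :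
  dot3 x y = x 0 0 * y 0 0 + x 0 1 * y 0 1 + x 0 2 * y 0 2.
Proof.
rewrite /dot3 !big_ord_recr big_ord0 /= add0r.
by congr (_ * _ + _ * _ + _ * _); congr (fun_of_matrix _ _ _); apply: val_inj.
Qed.

(* The form has the two isotropic vectors [(-a, -b, 1)] and [(a, b, 1)] and the
   vector [(b, -a, 0)] orthogonal to both; [isoL], [isoR], [isoM] are the
   pairings with them. *)
Section IsotropicCoordinates.
Variables (K : finFieldType) (a b : K).
Hypotheses (ab : a ^+ 2 + b ^+ 2 = -1) (two0 : 2 != 0 :> K).
Implicit Types x y : 'rV[K]_3.

Definition isoL x : K := x 0 2 - (a * x 0 0 + b * x 0 1).
Definition isoR x : K := x 0 2 + (a * x 0 0 + b * x 0 1).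
Definition isoM x : K := b * x 0 0 - a * x 0 1.

Lemma dot3_iso x y :
  2 * dot3 x y = isoL x * isoR y + isoR x * isoL y - 2 * (isoM x * isoM y).
Proof.
rewrite dot3E /isoL /isoR /isoM.
(* Inserting the factor [- (a ^+ 2 + b ^+ 2)], which is [1], turns the claim into a polynomial
   identity. *)
transitivity (2 * (x 0 2 * y 0 2)
  - 2 * (a ^+ 2 + b ^+ 2) * (x 0 0 * y 0 0 + x 0 1 * y 0 1)); last by ring.
by rewrite ab; ring.
Qed.

Lemma iso_inj x y l : isoL x = l * isoL y -> isoR x = l * isoR y ->
  isoM x = l * isoM y -> x = l *: y.
Proof.
(* [E0], [E1] and [E2] invert the change of coordinates, up to the invertible factor [2]. *)
have E0 (z : 'rV[K]_3) : 2 * z 0 0 = - (a * (isoR z - isoL z) + 2 * b * isoM z).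
  transitivity (- 2 * (a ^+ 2 + b ^+ 2) * z 0 0); first by rewrite ab; ring.
  by rewrite /isoL /isoR /isoM; ring.
have E1 (z : 'rV[K]_3) : 2 * z 0 1 = - (b * (isoR z - isoL z) - 2 * a * isoM z).
  transitivity (- 2 * (a ^+ 2 + b ^+ 2) * z 0 1); first by rewrite ab; ring.
  by rewrite /isoL /isoR /isoM; ring.
have E2 (z : 'rV[K]_3) : 2 * z 0 2 = isoR z + isoL z by rewrite /isoL /isoR; ring.
move=> EL ER EM; apply/rowP => i; rewrite mxE; apply: (mulfI two0).
rewrite mulrCA.
have [-> | [-> | ->]] : i = 0 \/ i = 1 \/ i = 2.
- by case: i => [[|[|[|//]]] i3]; [left | right; left | right; right];
    apply: val_inj.
- by rewrite !E0 EL ER EM; ring.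
- by rewrite !E1 EL ER EM; ring.
- by rewrite !E2 EL ER; ring.
Qed.

Definition PG2_repr (S : PG2 K) : 'rV[K]_3 := xchoose (existsP (valP S)).

Lemma PG2_repr_neq0 S : PG2_repr S != 0.
Proof. by have /andP[] := xchooseP (existsP (valP S)). Qed.

Lemma PG2_reprE S : val S = [set c *: PG2_repr S | c : K].
Proof. by have /andP[_ /eqP] := xchooseP (existsP (valP S)). Qed.

Lemma PG2_repr_inj S T l : PG2_repr S = l *: PG2_repr T -> S = T.
Proof.
move=> ST; have l0 : l != 0.
  by apply: contraNneq (PG2_repr_neq0 S) => l0; rewrite ST l0 scale0r.
apply: val_inj; rewrite !PG2_reprE; apply/setP => v.
apply/imsetP/imsetP => -[c _ ->].
  by exists (c * l); rewrite // ST scalerA.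
by exists (c / l); rewrite // ST scalerA divfK.
Qed.

Lemma ER_adj_repr S T :
  ER_adj S T -> dot3 (PG2_repr S) (PG2_repr T) = 0.
Proof.
have repr_in U : PG2_repr U \in val U.
  by rewrite PG2_reprE; apply/imsetP; exists 1; rewrite ?scale1r.
move=> /andP[_ /forallP/(_ (PG2_repr S))/implyP/(_ (repr_in S))].
by move=> /forallP/(_ (PG2_repr T))/implyP/(_ (repr_in T))/eqP.
Qed.

(** Points with [l = 0] and [m <> 0] are pairwise nonadjacent, since twice the form reduces to
    [- 2 m m'] there; only one point can have [l = m = 0]. *)
Lemma chromatic_ER_le (C : finType) (col : K * K -> C) :
  (forall P Q, P != Q -> P.2 + Q.2 = - (P.1 - Q.1) ^+ 2 -> col P != col Q) ->
  (chromatic_number (@ER_adj K) <= #|C| + 2)%N.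
Proof.
move=> colP.
pose pt x : K * K := (isoM x / isoL x, isoR x / isoL x - (isoM x / isoL x) ^+ 2).
pose colS S : option (option C) := let x := PG2_repr S in
  if isoL x != 0 then Some (Some (col (pt x)))
  else if isoM x != 0 then Some None else None.
rewrite addn2 -!card_option; apply: (@chromatic_number_le _ _ _ colS) => S T ST.
move=> /ER_adj_repr; set x := PG2_repr S; set y := PG2_repr T => xy0.
have STneq l : x != l *: y.
  by apply: contraNneq ST => /PG2_repr_inj ->.
have := dot3_iso x y; rewrite xy0 mulr0 => /esym/eqP; rewrite subr_eq0 => /eqP D.
rewrite /colS -/x -/y; have [Lx|Lx] := eqVneq (isoL x) 0;
  have [Ly|Ly] := eqVneq (isoL y) 0 => //=.
- have [Mx|Mx] := eqVneq (isoM x) 0;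
  have [My|My] := eqVneq (isoM y) 0 => //=.
    have Ry : isoR y != 0.
      apply: contraNneq (PG2_repr_neq0 T) => Ry; rewrite -/y.
      by rewrite (@iso_inj y 0 0) ?scaler0 ?mul0r.
    have := STneq (isoR x / isoR y).
    by rewrite -(@iso_inj x y (isoR x / isoR y)) ?eqxx ?Lx ?Ly ?Mx ?My ?mulr0 ?divfK.
  move: D; rewrite Lx Ly mul0r mulr0 addr0 => /esym/eqP.
  by rewrite !mulf_eq0 (negPf two0) (negPf Mx) (negPf My).
- by case: ifP.
- by case: ifP.
apply: colP => /=.
  apply: contra (STneq (isoL x / isoL y)) => /eqP[EM ER].
  move: ER; rewrite EM => /addIr ER.
  apply/eqP/iso_inj; first by rewrite divfK.
    by rewrite mulrAC -mulrA -ER mulrC divfK.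
  by rewrite mulrAC -mulrA -EM mulrC divfK.
(* This is the orthogonality relation divided by [l l']. *)
have E : isoR x / isoL x + isoR y / isoL y
         = 2 * (isoM x / isoL x * (isoM y / isoL y)).
  apply: (mulIf (mulf_neq0 Lx Ly)).
  transitivity (isoL x * isoR y + isoR x * isoL y); first by field; rewrite Lx Ly.
  by rewrite D; field; rewrite Lx Ly.
by rewrite addrACA E; ring.
Qed.

End IsotropicCoordinates.

(** The constant [3] counts the extra greedy color and the two colors for [l = 0]. *)
Lemma chromatic_ER_bound (K : finFieldType) (p m k : nat) :
  prime p -> odd p -> #|K| = (p ^ m)%N -> (0 < k <= m)%N ->
  (chromatic_number (@ER_adj K) <= 2 * p ^ (2 * k).-1 + 2 * p ^ (m - k) + 3)%N.
Proof.
move=> pp oddp cK km; have two0 := two_neq0 pp oddp cK.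
have oddK : odd #|K| by rewrite cK oddX oddp orbT.
have [a [b ab]] := sum_two_sqr_eqN1 oddK.
have [f [g [gB gW fg]]] := additive_quotients pp cK km.
have [col colP] := parabola_coloring two0 gB gW fg.
apply: leq_trans (chromatic_ER_le ab two0 colP) _.
by rewrite card_sum card_prod card_bool !card_ord; lia.
Qed.

(* Numerical estimates *)
From Stdlib Require Import Reals Lra.
Local Close Scope ring_scope.

(* Once [Reals] is imported, [^] on [nat] denotes [Nat.pow]. *)
Lemma natpowE (m n : nat) : Nat.pow m n = expn m n.
Proof. by elim: n => [//|n IHn]; rewrite expnS -IHn. Qed.

Lemma INR_addn (m n : nat) : INR (m + n) = (INR m + INR n)%R.
Proof. exact: plus_INR. Qed.

Lemma INR_muln (m n : nat) : INR (m * n) = (INR m * INR n)%R.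
Proof. exact: mult_INR. Qed.

Lemma INR_expn (m n : nat) : INR (expn m n) = (INR m ^ n)%R.
Proof. by rewrite -natpowE pow_INR. Qed.

(** Exponents are compared in base [p], since [j] need not be a multiple of [e]. *)
Lemma INR_expn_le_Rpower (p e j : nat) (y : R) :
  (0 < p)%N -> (INR j <= INR e * y)%R ->
  (INR (expn p j) <= Rpower (INR (expn p e)) y)%R.
Proof.
move=> p0 jy; have p1 : (1 <= INR p)%R by apply: (le_INR 1); apply/leP.
rewrite !INR_expn -!Rpower_pow; try lra.
by rewrite Rpower_mult; apply: Rle_Rpower.
Qed.

Theorem theorem1p2 (p e r : nat) (F K : finFieldType) :
  prime p -> odd p -> odd e -> (1 <= r)%N ->
  #|F| = (p ^ e)%N -> #|K| = ((p ^ e) ^ (2 * r + 1))%N ->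
  (exists mu : F, irreducible_poly (Xn_sub_C (2 * r + 1) mu)) ->
  (INR (chromatic_number (@ER_adj K))
   <= INR (2 * r + 5) / 3 * Rpower (INR (p ^ e)) (INR (4 * r) / 3 + 1)
      + INR (2 * r + 1) * INR (p ^ e) ^ (r + 1) + 1)%R.
Proof.
move=> pp oddp odde r1 _ cK _; rewrite !natpowE -expnM in cK *.
have e1 : (1 <= e)%N by case: (e) odde.
have p0 := prime_gt0 pp.
have p3 : (3 <= p)%N by case: (p) pp oddp => [|[|[|]]].
(* [k] is [2 r e / 3] rounded up, the least value for which [p ^ (m - k)] is at most
   [(p ^ e) ^ (4 r / 3 + 1)]. *)
pose k := ((2 * r * e + 2) %/ 3)%N; pose m := (e * (2 * r + 1))%N.
have re : (e <= r * e)%N by rewrite leq_pmull.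
have k_lb : (2 * r * e <= 3 * k)%N by rewrite /k; lia.
have k_ub : (3 * k <= 2 * r * e + 2)%N by rewrite /k; lia.
have km : (0 < k <= m)%N by rewrite /m; nia.
have chi := le_INR _ _ (leP (chromatic_ER_bound pp oddp cK km)).
apply: (Rle_trans _ _ _ chi) => {chi}.
rewrite -/m -INR_expn -expnM (INR_addn _ 3) (INR_addn (2 * _)).
rewrite (INR_addn _ 5) (INR_addn _ 1) !INR_muln.
set B := Rpower _ _; set Q := INR (expn p (e * (r + 1))).
rewrite (INR_IZR_INZ 1) (INR_IZR_INZ 2) (INR_IZR_INZ 3) (INR_IZR_INZ 5).
rewrite [Z.of_nat 1]/= [Z.of_nat 2]/= [Z.of_nat 3]/= [Z.of_nat 5]/=.
have e1R : (1 <= INR e)%R by apply: (le_INR 1); apply/leP.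
have r1R : (1 <= INR r)%R by apply: (le_INR 1); apply/leP.
have high_le : (INR (expn p (m - k)) <= B)%R.
  apply: INR_expn_le_Rpower => //.
  have : (3 * (m - k) <= e * (4 * r + 3))%N by rewrite /m; nia.
  move/leP/le_INR; rewrite !INR_muln (INR_addn _ 3) INR_muln.
  rewrite (INR_IZR_INZ 3) (INR_IZR_INZ 4) /=; lra.
have Q9 : (9 <= Q)%R.
  rewrite (_ : 9%R = INR 9); last by rewrite INR_IZR_INZ.
  apply/le_INR/leP; apply: (@leq_trans (expn p 2)); first exact: (leq_mul p3 p3).
  by rewrite leq_exp2l; [nia | lia].
have B0 : (0 < B)%R by apply: exp_pos.
(* For [r <= 3] the exponent [2k - 1] is at most [e (r + 1)], so the [Q] term absorbs the first
   power. For [r >= 4] both powers are at most [B], and [(2 r + 5) / 3 >= 4] covers their total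
   weight. *)
have [r3|r4] := leqP r 3.
  have low_le : (INR (expn p (2 * k).-1) <= Q)%R.
    apply/le_INR/leP; rewrite leq_exp2l; last by lia.
    by case: (r) r1 r3 k_lb k_ub => [|[|[|[|]]]] //; lia.
  nra.
have low_le : (INR (expn p (2 * k).-1) <= B)%R.
  apply: INR_expn_le_Rpower => //.
  have : (3 * (2 * k).-1 <= e * (4 * r + 3))%N by nia.
  move/leP/le_INR; rewrite !INR_muln (INR_addn _ 3) INR_muln.
  rewrite (INR_IZR_INZ 3) (INR_IZR_INZ 4) /=; lra.
have r4R : (4 <= INR r)%R.
  by rewrite (_ : 4%R = INR 4); [apply/le_INR/leP | rewrite INR_IZR_INZ].
nra.
Qed.
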